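(* Assume that $\mathrm{tr}(HV^\top)=0$. Let $y=(y_{n_1,n_2})_{0\le n_1<N_1,\,0\le n_2<N_2}\in\mathbb{R}^{N_1\times N_2}$ and $\mu>0$. Then, for every $(p_1,p_2)\in\{0,\ldots,P_1-1\}\times\{0,\ldots,P_2-1\}$, $$\mathrm{prox}_{\mu\,\mathrm{tv}_{p_1,p_2}}\,y=(\pi_{n_1,n_2})_{0\le n_1<N_1,\,0\le n_2<N_2},$$ where, for every $(n_1,n_2)\in\{0,\ldots,\lfloor\frac{N_1-p_1}{P_1}\rfloor-1\}\times\{0,\ldots,\lfloor\frac{N_2-p_2}{P_2}\rfloor-1\}$, $$(\pi_{P_1n_1+p_1+p_1',\,P_2n_2+p_2+p_2'})_{0\le p_1'<P_1,\,0\le p_2'<P_2}=(\beta_{n_1,n_2}^{p_1,p_2}-h_{n_1,n_2}^{p_1,p_2})\,H+(\kappa_{n_1,n_2}^{p_1,p_2}-v_{n_1,n_2}^{p_1,p_2})\,V+Y_{n_1,n_2}^{p_1,p_2}$$ with $$h_{n_1,n_2}^{p_1,p_2}=\mathrm{tr}(H^\top Y_{n_1,n_2}^{p_1,p_2}),\qquad v_{n_1,n_2}^{p_1,p_2}=\mathrm{tr}(V^\top Y_{n_1,n_2}^{p_1,p_2}),$$ $$(\beta_{n_1,n_2}^{p_1,p_2},\kappa_{n_1,n_2}^{p_1,p_2})=\mathrm{prox}_{\mu\,\rho_{\mathrm{tv}}}(h_{n_1,n_2}^{p_1,p_2},v_{n_1,n_2}^{p_1,p_2}),$$ and, for every $(n_1,n_2)\in\{0,\ldots,N_1-1\}\times\{0,\ldots,N_2-1\}$,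 $$\pi_{n_1,n_2}=y_{n_1,n_2}\quad\text{if } n_1<p_1,\ \text{or } n_2<p_2,\ \text{or } n_1\ge p_1+P_1\Big\lfloor\frac{N_1-p_1}{P_1}\Big\rfloor,\ \text{or } n_2\ge p_2+P_2\Big\lfloor\frac{N_2-p_2}{P_2}\Big\rfloor.$$
   Context: $N_1,N_2,P_1,P_2$ are positive integers (image size and filter size). For a finite-dimensional Euclidean space $E$, $\Gamma_0(E)$ is the class of proper lower semicontinuous convex functions $\varphi:E\to\,]-\infty,+\infty]$; for $\varphi\in\Gamma_0(E)$, $\mathrm{prox}_\varphi(u)$ is the unique minimizer over $w\in E$ of $\frac12\|w-u\|^2+\varphi(w)$, where $\|\cdot\|$ is the Euclidean norm (on $\mathbb{R}^{N_1\times N_2}$, the Frobenius norm). $\rho_{\mathrm{tv}}\in\Gamma_0(\mathbb{R}^2)$ is a given function, and $H,V\in\mathbb{R}^{P_1\times P_2}$ are given filter kernel matrices, assumed to have unit Frobenius norm. For $y\in\mathbb{R}^{N_1\times N_2}$, $p_1\in\{0,\ldots,P_1-1\}$, $p_2\in\{0,\ldots,P_2-1\}$, and $(n_1,n_2)\in\{0,\ldots,\lfloor\frac{N_1-p_1}{P_1}\rfloor-1\}\times\{0,\ldots,\lfloor\frac{N_2-p_2}{P_2}\rfloor-1\}$, the block $$Y_{n_1,n_2}^{p_1,p_2}=(y_{P_1n_1+p_1+p_1',\,P_2n_2+p_2+p_2'})_{0\le p_1'<P_1,\,0\le p_2'<P_2}\in\mathbb{R}^{P_1\times P_2}$$ is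 the corresponding block of $P_1\times P_2$ neighbouring pixels of $y$. The function $\mathrm{tv}_{p_1,p_2}:\mathbb{R}^{N_1\times N_2}\to\,]-\infty,+\infty]$ is $$\mathrm{tv}_{p_1,p_2}(y)=\sum_{n_1=0}^{\lfloor\frac{N_1-p_1}{P_1}\rfloor-1}\ \sum_{n_2=0}^{\lfloor\frac{N_2-p_2}{P_2}\rfloor-1}\rho_{\mathrm{tv}}\big(\mathrm{tr}(H^\top Y_{n_1,n_2}^{p_1,p_2}),\,\mathrm{tr}(V^\top Y_{n_1,n_2}^{p_1,p_2})\big),$$ with empty sums equal to $0$. *)

(* Defs.v *)
(* MathComp-Analysis, over an arbitrary R : realType. *)
From HB Require Import structures.
From mathcomp Require Import all_boot all_order all_algebra.
From mathcomp Require Import all_classical all_reals all_analysis.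
Set Implicit Arguments.
Unset Strict Implicit.
Unset Printing Implicit Defensive.
Import Order.TTheory GRing.Theory Num.Theory.
Import numFieldNormedType.Exports.
Local Open Scope classical_set_scope.
Local Open Scope ring_scope.

(* The Euclidean spaces in use are 'M[R]_(m, n) with the Frobenius norm; R^2 is
   'rV[R]_2 = 'M[R]_(1, 2), on which the Frobenius norm is the Euclidean norm.
   The library's norm `|A| on matrices is the sup norm: it induces the same
   topology, so it is used for semicontinuity, but not in the prox. *)
Section Prox.
Context {R : realType} {m n : nat}.
Implicit Types (phi : 'M[R]_(m, n) -> \bar R) (u w p q : 'M[R]_(m, n)).

Definition frobenius (A : 'M[R]_(m, n)) : R :=
  Num.sqrt (\sum_(i < m) \sum_(j < n) A i j ^+ 2).

Definition eproper phi : Prop :=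
  (forall x, phi x != -oo%E) /\ (exists x, phi x != +oo%E).

Definition econvex phi : Prop :=
  forall (x y : 'M[R]_(m, n)) (t : R), 0 < t < 1 ->
    (phi (t *: x + (1 - t) *: y)%R <= t%:E * phi x + (1 - t)%R%:E * phi y)%E.

Definition Gamma0 phi : Prop :=
  [/\ eproper phi, lower_semicontinuous phi & econvex phi].

Definition prox_objective phi u w : \bar R :=
  ((2^-1 * frobenius (w - u) ^+ 2)%:E + phi w)%E.

Definition is_minimizer (f : 'M[R]_(m, n) -> \bar R) p : Prop :=
  forall w, (f p <= f w)%E.

Definition is_prox phi u p : Prop :=
  is_minimizer (prox_objective phi u) p /\
  (forall q, is_minimizer (prox_objective phi u) q -> q = p).

(* For phi in Gamma0 the unique minimizer exists; the default value 0 is only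
   returned for functions outside the domain of the definition. *)
Definition prox phi u : 'M[R]_(m, n) := xget 0 [set p | is_prox phi u p].

End Prox.

Definition vec2 (R : realType) (a b : R) : 'rV[R]_2 :=
  \row_(j < 2) (if j == 0 then a else b).

Section Blocks.
Local Open Scope nat_scope.

(* floor ((N - p) / P).  The subtraction is truncated: when N < p the floor is
   negative, nblocks is 0, and the range of block indices is empty either way. *)
Definition nblocks (N P p : nat) : nat := (N - p) %/ P.

Lemma block_index_subproof (N P p : nat) (k : 'I_(nblocks N P p)) (i : 'I_P) :
  P * k + p + i < N.
Proof.
have P_gt0 : 0 < P by apply: leq_ltn_trans (ltn_ord i).
have : P * k.+1 <= N - p.
  by rewrite mulnC (leq_trans _ (leq_divM (N - p) P)) // leq_mul2r ltn_ord orbT.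
rewrite mulnS => le_PN.
have lt_kN : P * k + i < N - p.
  by apply: leq_trans le_PN; rewrite addnC ltn_add2r.
by move: lt_kN; rewrite ltn_subRL addnCA addnA.
Qed.

Definition block_index (N P p : nat) (k : 'I_(nblocks N P p)) (i : 'I_P) : 'I_N :=
  Ordinal (block_index_subproof k i).

End Blocks.

Definition block (R : realType) (N1 N2 P1 P2 p1 p2 : nat) (y : 'M[R]_(N1, N2))
    (n1 : 'I_(nblocks N1 P1 p1)) (n2 : 'I_(nblocks N2 P2 p2)) : 'M[R]_(P1, P2) :=
  \matrix_(i < P1, j < P2) y (block_index n1 i) (block_index n2 j).

Definition tv (R : realType) (N1 N2 P1 P2 : nat) (rho : 'rV[R]_2 -> \bar R)
    (H V : 'M[R]_(P1, P2)) (p1 p2 : nat) (y : 'M[R]_(N1, N2)) : \bar R :=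
  (\sum_(n1 < nblocks N1 P1 p1) \sum_(n2 < nblocks N2 P2 p2)
     rho (vec2 (\tr (H^T *m block y n1 n2)) (\tr (V^T *m block y n1 n2))))%E.

(* Main.v *)
Require Import Defs.
From HB Require Import structures.
From mathcomp Require Import all_boot all_order all_algebra.
From mathcomp Require Import all_classical all_reals all_analysis.
From mathcomp Require Import ring lra.
Set Implicit Arguments.
Unset Strict Implicit.
Unset Printing Implicit Defensive.
Import Order.TTheory GRing.Theory Num.Theory.
Import numFieldNormedType.Exports.
Local Open Scope classical_set_scope.
Local Open Scope ring_scope.

(** The function tv is separable in the coordinates of the image along an
    orthonormal family: the copies of H and V placed on the blocks.  These are
    orthonormal because the blocks are disjoint and because H and V are
    orthogonal unit matrices.

    In general, let E i j (i in a finite type, j < k) be an orthonormal family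
    of matrices, c_i(w) the vector of the inner products of w with the E i j,
    and g(w) the sum over i of rho(c_i(w)).  By Bessel's inequality,
      1/2 |w - y|^2 + g(w) >= sum_i (1/2 |c_i(w) - c_i(y)|^2 + rho(c_i(w))),
    with equality when w - y is in the span of the family.  Each term on the
    right is minimal when c_i(w) = prox_rho(c_i(y)), and the point
    y + sum_ij (prox_rho(c_i(y)) - c_i(y))_j E i j achieves all these minima
    together with the equality ([prox_separable]).  The theorem is the case of
    mu rho in place of rho: reading this point inside a block gives the formula in H and V; outside the blocks every E i j vanishes,
    so that y is unchanged.

    The argument uses that prox_rho is a minimizer and that a minimizer of
    the objective of g is its prox, for rho and g in Gamma0.  Both rest on the
    strong convexity of the objective ([prox_sublevel_diameter]), which gives
    uniqueness and makes the sublevel sets near the infimum shrink, so that they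
    converge by completeness ([prox_objective_has_minimizer]). *)

(** * The Frobenius inner product *)

Section FrobeniusProduct.
Context {R : realType} {m n : nat}.
Implicit Types A B C : 'M[R]_(m, n).

(** The form in which the filter responses tr(H^T Y) and tr(V^T Y) are
    written; its quadratic form is the squared Frobenius norm. *)
Definition mxdot A B : R := \tr (A^T *m B).

Lemma mxdotE A B : mxdot A B = \sum_i \sum_j A i j * B i j.
Proof.
rewrite /mxdot /mxtrace exchange_big; apply: eq_bigr => j _.
by rewrite mxE; apply: eq_bigr => i _; rewrite mxE.
Qed.

Lemma mxdotC A B : mxdot A B = mxdot B A.
Proof. by rewrite /mxdot -mxtrace_tr trmx_mul trmxK. Qed.

Lemma mxdot_is_linear A : linear_for *%R (mxdot A).
Proof. by move=> a B C; rewrite /mxdot mulmxDr -scalemxAr mxtraceD mxtraceZ. Qed.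

HB.instance Definition _ A :=
  GRing.isLinear.Build R 'M[R]_(m, n) R *%R (mxdot A) (mxdot_is_linear A).

Lemma mxdotBB A B :
  mxdot (A - B) (A - B) = mxdot A A - 2 * mxdot A B + mxdot B B.
Proof.
by rewrite !linearB /= ![mxdot (A - B) _]mxdotC !linearB /= (mxdotC B A); ring.
Qed.

Lemma mxdotDD A B :
  mxdot (A + B) (A + B) = mxdot A A + 2 * mxdot A B + mxdot B B.
Proof.
by rewrite !linearD /= ![mxdot (A + B) _]mxdotC !linearD /= (mxdotC B A); ring.
Qed.

Lemma mxdotZZ a A : mxdot (a *: A) (a *: A) = a ^+ 2 * mxdot A A.
Proof. by rewrite linearZ /= mxdotC linearZ /= mulrA. Qed.

Lemma mxdot_ge0 A : 0 <= mxdot A A.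
Proof.
by rewrite mxdotE; do 2!apply: sumr_ge0 => ? _; rewrite -expr2 sqr_ge0.
Qed.

Lemma entry_sqr_le A i j : A i j ^+ 2 <= mxdot A A.
Proof.
have sq_ge0 (i' : 'I_m) (j' : 'I_n) : 0 <= A i' j' * A i' j'.
  by rewrite -expr2 sqr_ge0.
rewrite mxdotE (bigD1 i) //= (bigD1 j) //= -expr2 -addrA lerDl addr_ge0 ?sumr_ge0 //.
by move=> i' _; apply: sumr_ge0.
Qed.

Lemma mxdot_eq0 A : mxdot A A <= 0 -> A = 0.
Proof.
move=> A_le0; apply/matrixP => i j; apply/eqP; rewrite mxE -sqrf_eq0.
by rewrite eq_le sqr_ge0 (le_trans (entry_sqr_le A i j)).
Qed.

Lemma frobenius_sqr A : frobenius A ^+ 2 = mxdot A A.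
Proof.
rewrite /frobenius sqr_sqrtr; last by do 2!apply: sumr_ge0 => ? _; rewrite sqr_ge0.
by rewrite mxdotE; under eq_bigr do under eq_bigr do rewrite expr2.
Qed.

(** The topology of matrices comes from the sup norm, whereas the proximity
    operator is built on the Frobenius norm: this is the one comparison of the
    two that is used to transfer estimates. *)
Lemma norm_sqr_le A : `|A| ^+ 2 <= mxdot A A.
Proof.
rewrite -(sqr_sqrtr (mxdot_ge0 A)) lerXn2r ?nnegrE ?sqrtr_ge0 //.
rewrite [leLHS]/Num.norm /= mx_normrE; apply: bigmax_le => [|[i j] _ /=].
  exact: sqrtr_ge0.
by rewrite -sqrtr_sqr ler_wsqrtr ?entry_sqr_le.
Qed.

Lemma mxdot_continuous A : continuous (mxdot A).
Proof.
have -> : mxdot A = fun B => \sum_i \sum_j A i j * B i j.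
  by apply/funext => B; rewrite mxdotE.
do 2!(apply: continuous_big => [|? _]; first exact: add_continuous).
move=> B.
by apply: continuousM; [exact: cst_continuous|exact: coord_continuous].
Qed.

Lemma mxdotBB_continuous u :
  continuous (fun w : 'M[R]_(m, n) => mxdot (w - u) (w - u)).
Proof.
have -> : (fun w : 'M[R]_(m, n) => mxdot (w - u) (w - u)) =
    fun w => \sum_i \sum_j (w i j - u i j) * (w i j - u i j).
  apply/funext => w; rewrite mxdotE; do 2!apply: eq_bigr => ? _.
  by rewrite !mxE.
have cB (i : 'I_m) (j : 'I_n) : continuous (fun w : 'M[R]_(m, n) => w i j - u i j).
  move=> B; pose ev (w : 'M[R]_(m, n)) : R := w i j.
  apply: (@continuousB _ _ _ ev (cst (u i j))).
    exact: coord_continuous.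
  exact: cst_continuous.
apply: continuous_big => [|i _]; first exact: add_continuous.
apply: continuous_big => [|j _]; first exact: add_continuous.
move=> B.
pose d (w : 'M[R]_(m, n)) : R := w i j - u i j.
by apply: (@continuousM _ _ d d); exact: cB.
Qed.

End FrobeniusProduct.

(** * Sums of extended reals without -oo *)

Lemma sume_neqNy (R : realType) (I : Type) (r : seq I) (x_ : I -> \bar R) :
  (forall i, x_ i != -oo%E) -> (\sum_(i <- r) x_ i != -oo)%E.
Proof.
by move=> xNy; elim/big_ind: _ => // x y xN yN; rewrite adde_eq_ninfty negb_or xN.
Qed.

Lemma adde_def_neqNy (R : numDomainType) (x y : \bar R) :
  x != -oo%E -> y != -oo%E -> (x +? y)%E.
Proof. by case: x; case: y. Qed.

Lemma pmule_neqNy (R : realDomainType) (r : R) (x : \bar R) :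
  0 < r -> x != -oo%E -> (r%:E * x)%E != -oo%E.
Proof. by move=> r_gt0; case: x => [s||] // _; rewrite gt0_muley. Qed.

Lemma fin_mule_sumr (R : realDomainType) (I : Type) (s : seq I) (r : R)
    (x_ : I -> \bar R) :
  (forall i, x_ i != -oo%E) ->
  (r%:E * \sum_(i <- s) x_ i = \sum_(i <- s) r%:E * x_ i)%E.
Proof.
by move=> xNy; apply: fin_num_sume_distrr => // i j _ _; exact: adde_def_neqNy.
Qed.

(** * Lower semicontinuity *)

(** Room for a sum is shared between its two terms: this reduces lower
    semicontinuity of a sum to that of the summands. *)
Lemma lte_addP (R : realType) (x y : \bar R) (a : R) :
  x != -oo%E -> y != -oo%E -> (a%:E < x + y)%E ->
  exists2 b, (b%:E < x)%E & ((a - b)%:E < y)%E.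
Proof.
case: x => [r||] // _; case: y => [s||] // _.
(* Two finite terms: the slack r + s - a is split evenly. *)
- rewrite -EFinD lte_fin => ars; exists (r - (r + s - a) / 2); rewrite lte_fin; lra.
- by exists (r - 1); rewrite ?ltry // lte_fin; lra.
- by exists (a - (s - 1)); rewrite ?ltry // lte_fin; lra.
- by exists 0; rewrite ltry.
Qed.

Section LowerSemicontinuity.
Context {R : realType} {X Y : topologicalType}.
Implicit Types f g : X -> \bar R.

Lemma lower_semicontinuousD f g :
  (forall x, f x != -oo%E) -> (forall x, g x != -oo%E) ->
  lower_semicontinuous f -> lower_semicontinuous g ->
  lower_semicontinuous (fun x => f x + g x)%E.
Proof.
move=> fNoo gNoo lf lg x a /lte_addP[]// b /lf[V Vx Vf] /lg[W Wx Wg].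
exists (V `&` W); first exact: filterI.
move=> z [/Vf bf /Wg abg].
by rewrite -[a](subrKC b) EFinD lteD.
Qed.

Lemma lower_semicontinuous_comp (h : Y -> \bar R) (k : X -> Y) :
  continuous k -> lower_semicontinuous h -> lower_semicontinuous (h \o k).
Proof.
move=> ck lh x a /lh[V Vx Vh]; exists (k @^-1` V); first exact: ck.
by move=> z /Vh.
Qed.

Lemma continuous_lower_semicontinuous (f : X -> R) :
  continuous f -> lower_semicontinuous (EFin \o f).
Proof.
move=> cf x a /=; rewrite lte_fin => afx; exists (f @^-1` [set r | a < r]).
  by apply: cf; apply: open_nbhs_nbhs; split => //; exact: open_gt.
by move=> z /=; rewrite lte_fin.
Qed.

Lemma lower_semicontinuous_sum (I : Type) (r : seq I) (f_ : I -> X -> \bar R) :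
  (forall i x, f_ i x != -oo%E) -> (forall i, lower_semicontinuous (f_ i)) ->
  lower_semicontinuous (fun x => \sum_(i <- r) f_ i x)%E.
Proof.
move=> fNoo lf; elim: r => [|i r IH].
  have -> : (fun x => \sum_(i <- [::]) f_ i x)%E = (EFin \o cst 0).
    by apply/funext => x; rewrite big_nil.
  by apply: continuous_lower_semicontinuous => x; exact: cvg_cst.
have -> : (fun x => \sum_(j <- i :: r) f_ j x)%E =
    (fun x => f_ i x + \sum_(j <- r) f_ j x)%E.
  by apply/funext => x; rewrite big_cons.
apply: lower_semicontinuousD => // x; exact: sume_neqNy.
Qed.

End LowerSemicontinuity.

(** * Existence and uniqueness of the proximity operator *)

Section ProxExistence.
Context {R : realType} {m n : nat}.
Variables (phi : 'M[R]_(m, n) -> \bar R) (u : 'M[R]_(m, n)).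
Hypothesis phi_Gamma0 : Gamma0 phi.

Let phi_neqNy x : phi x != -oo%E.
Proof. by case: phi_Gamma0 => -[]. Qed.

Let phi_finite_somewhere : exists x r, phi x = r%:E.
Proof.
have [[_ [x x_fin]] _ _] := phi_Gamma0; exists x.
by move: x_fin (phi_neqNy x); case: (phi x) => [r||] // _ _; exists r.
Qed.

Lemma prox_objectiveE w :
  prox_objective phi u w = ((2^-1 * mxdot (w - u) (w - u))%:E + phi w)%E.
Proof. by rewrite /prox_objective frobenius_sqr. Qed.

Lemma prox_objective_lsc : lower_semicontinuous (prox_objective phi u).
Proof.
pose d (w : 'M[R]_(m, n)) : R := mxdot (w - u) (w - u).
have -> : prox_objective phi u = fun w => ((EFin \o (cst 2^-1 \* d)%R) w + phi w)%E.
  by apply/funext => w; rewrite prox_objectiveE.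
apply: lower_semicontinuousD => //; last by case: phi_Gamma0.
apply: continuous_lower_semicontinuous => w.
by apply: continuousM; [exact: cst_continuous|exact: mxdotBB_continuous].
Qed.

Lemma prox_objective_le_fin w a : (prox_objective phi u w <= a%:E)%E ->
  exists2 r, phi w = r%:E & 2^-1 * mxdot (w - u) (w - u) + r <= a.
Proof.
rewrite prox_objectiveE; case: (phi w) (phi_neqNy w) => [r||] // _.
by rewrite -EFinD lee_fin; exists r.
Qed.

(** Strong convexity: by the parallelogram identity, the midpoint of p and q
    gains |p - q|^2 / 8 over the level a, and it cannot go below b.  With
    a = b this gives uniqueness of minimizers; with a tending to b it makes
    minimizing families Cauchy. *)
Lemma prox_sublevel_diameter p q a b :
  (forall w, b%:E <= prox_objective phi u w)%E ->
  (prox_objective phi u p <= a%:E)%E -> (prox_objective phi u q <= a%:E)%E ->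
  mxdot (p - q) (p - q) <= 8 * (a - b).
Proof.
move=> le_b /prox_objective_le_fin[r phip pa] /prox_objective_le_fin[s phiq qa].
pose mid := 2^-1 *: p + (1 - 2^-1) *: q.
have [_ _ /(_ p q 2^-1)] := phi_Gamma0.
rewrite invr_gt0 invf_lt1 ?ltr0n ?ltr1n // => /(_ isT).
rewrite -/mid phip phiq -!EFinM -EFinD => mid_le.
have := le_b mid; rewrite prox_objectiveE.
have phi_mid := phi_neqNy mid.
case: (phi mid) mid_le phi_mid => [t||] //.
rewrite -EFinD !lee_fin => t_le _ b_le.
have midE : mid - u = 2^-1 *: ((p - u) + (q - u)).
  by apply/matrixP => i j; rewrite !mxE; lra.
have pqE : p - q = (p - u) - (q - u) by rewrite opprB addrA subrK.
move: pa qa b_le; rewrite midE pqE; move: (p - u) (q - u) => P Q.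
by rewrite mxdotBB mxdotZZ mxdotDD; lra.
Qed.

(** Lower semicontinuity bounds phi from below on a ball of radius d around a
    point x0 of its domain; contracting w towards x0 into that ball, convexity
    turns this into the bound r0 - 1 - |w - x0| / d, valid everywhere.  The
    quadratic term dominates such a linear loss. *)
Lemma prox_objective_bounded_below :
  exists b, forall w, (b%:E <= prox_objective phi u w)%E.
Proof.
have [_ phi_lsc phi_cvx] := phi_Gamma0.
have [x0 [r0 phix0]] := phi_finite_somewhere.
have [|V /nbhs_ballP[d /= d_gt0 dV] Vphi] := phi_lsc x0 (r0 - 1).
  by rewrite phix0 lte_fin; lra.
(* s^2 / 2 - s / d is at least - d^-2 / 2, by completing the square. *)
exists (r0 - 1 - `|u - x0| / d - 2^-1 * d^-1 ^+ 2) => w.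
have phi_ge : ((r0 - 1 - `|w - x0| / d)%:E <= phi w)%E.
  have [->|w_neq] := eqVneq w x0.
    by rewrite phix0 subrr normr0 mul0r lee_fin; lra.
  have D_gt0 : 0 < `|w - x0| by rewrite normr_gt0 subr_eq0.
  move: D_gt0; set D := `|w - x0| => D_gt0.
  (* The contraction ratio t satisfies t * D < d and 1 / t = 1 + D / d. *)
  pose t := d / (d + D).
  have s_gt0 : 0 < d + D by exact: addr_gt0.
  have t_gt0 : 0 < t by exact: divr_gt0.
  have t_lt1 : t < 1 by rewrite ltr_pdivrMr // mul1r ltrDl.
  have /Vphi : V (t *: w + (1 - t) *: x0).
    apply: dV; rewrite -ball_normE /=.
    have -> : x0 - (t *: w + (1 - t) *: x0) = - t *: (w - x0).
      by apply/matrixP => i j; rewrite !mxE; ring.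
    rewrite normrZ normrN gtr0_norm // -/D /t mulrAC -mulrA gtr_pMr //.
    by rewrite ltr_pdivrMr // mul1r ltrDr.
  have /= := phi_cvx w x0 t; rewrite t_gt0 t_lt1 => /(_ isT) cvx lt_r0.
  have := lt_le_trans lt_r0 cvx; rewrite phix0.
  case: (phi w) (phi_neqNy w) => [r||] // _; last by rewrite leey.
  rewrite -!EFinM -EFinD lte_fin lee_fin => ineq.
  have : - 1 < t * (r - r0) by lra.
  rewrite -ltr_pdivrMl // mulrN1 /t invf_div mulrDl divff ?gt_eqF //.
  by move=> ?; lra.
rewrite prox_objectiveE; apply: le_trans (leeD (lexx _) phi_ge).
rewrite -EFinD lee_fin.
have tri : `|w - x0| <= `|w - u| + `|u - x0| by rewrite ler_distD.
have := norm_sqr_le (w - u); set S := mxdot _ _ => S_ge.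
have dV_gt0 : 0 < d^-1 by rewrite invr_gt0.
have : `|w - x0| / d <= (`|w - u| + `|u - x0|) / d by rewrite ler_pM2r.
rewrite mulrDl; have := sqr_ge0 (`|w - u| - d^-1); rewrite sqrrB.
by move: (`|w - u|) S_ge => s; lra.
Qed.

Lemma prox_unique p q : is_minimizer (prox_objective phi u) p ->
  is_minimizer (prox_objective phi u) q -> q = p.
Proof.
move=> min_p min_q; have [x0 [r0 phix0]] := phi_finite_somewhere.
have := min_p x0; rewrite [X in (_ <= X)%E]prox_objectiveE phix0 -EFinD.
move=> /prox_objective_le_fin[r phip _].
have fp : prox_objective phi u p = (2^-1 * mxdot (p - u) (p - u) + r)%:E.
  by rewrite prox_objectiveE phip.
apply/eqP; rewrite -subr_eq0; apply/eqP/mxdot_eq0.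
rewrite -[X in _ <= X](mulr0 8).
rewrite -[X in _ <= 8 * X](subrr (2^-1 * mxdot (p - u) (p - u) + r)).
by apply: prox_sublevel_diameter => [w||]; rewrite -fp.
Qed.

(** The sublevel sets above the infimum generate a Cauchy filter; it converges
    by completeness, and lower semicontinuity puts its limit at the infimum. *)
Lemma prox_objective_has_minimizer :
  exists p, is_minimizer (prox_objective phi u) p.
Proof.
set f := prox_objective phi u.
have [b f_ge] := prox_objective_bounded_below.
have [x0 [r0 phix0]] := phi_finite_somewhere.
have inf_fin : ereal_inf (range f) \is a fin_num.
  rewrite fin_numElt; apply/andP; split.
    apply: (@lt_le_trans _ _ b%:E); first exact: ltNyr.
    by apply: le_ereal_inf_tmp => _ [w _ <-].
  apply: (@le_lt_trans _ _ (f x0)); first by apply: ereal_inf_lbound; exists x0.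
  by rewrite /f prox_objectiveE phix0 -EFinD ltry.
pose i := fine (ereal_inf (range f)).
have i_le w : (i%:E <= f w)%E.
  by rewrite fineK //; apply: ereal_inf_lbound; exists w.
have i_adh e : 0 < e -> exists w, (f w <= (i + e)%:E)%E.
  move=> e_gt0; have [_ [w _ <-] /ltW w_le] := lb_ereal_inf_adherent e_gt0 inf_fin.
  by exists w; rewrite EFinD fineK.
pose S e := [set w | (f w <= (i + e)%:E)%E].
pose F := filter_from [set e : R | 0 < e] S.
have FF : ProperFilter F.
  apply: filter_from_proper => [|e e_gt0]; last exact: i_adh.
  apply: filter_from_filter; first by exists 1; exact: ltr01.
  move=> d e d_gt0 e_gt0; exists (Num.min d e) => [|w /= w_le].
    by rewrite /= lt_min d_gt0.
  by split; apply: (le_trans w_le); rewrite lee_fin lerD2l ge_min lexx ?orbT.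
have F_cvg : cvg F.
  (* The sublevel set at i + d has squared diameter at most 8 * d, which is
     e^2 / 2 for d = e^2 / 16. *)
  apply: cauchy_cvg; apply: cauchy_exP => e e_gt0.
  have d_gt0 : 0 < e ^+ 2 / 16 by rewrite divr_gt0 ?exprn_gt0.
  have [x Sx] := i_adh _ d_gt0.
  exists x; exists (e ^+ 2 / 16) => // w Sw.
  rewrite -ball_normE /= -(@ltr_pXn2r _ 2) // ?nnegrE ?(ltW e_gt0) //.
  apply: le_lt_trans (norm_sqr_le _) _.
  apply: le_lt_trans (prox_sublevel_diameter i_le Sx Sw) _.
  by have := exprn_gt0 2 e_gt0; lra.
exists (lim F) => w; apply: le_trans (i_le w); rewrite leNgt; apply/negP => i_lt.
have [a ia /prox_objective_lsc[V V_lim Vf]] :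
    exists2 a, i < a & (a%:E < f (lim F))%E.
  case: (f (lim F)) i_lt => [r||] //; rewrite ?lte_fin => ir.
    by exists ((i + r) / 2); rewrite ?lte_fin; lra.
  by exists (i + 1); rewrite ?ltry //; lra.
have [e /= e_gt0 SV] : F V by exact: F_cvg V_lim.
have [|x x_le] := i_adh (Num.min e (a - i)); first by rewrite lt_min e_gt0 subr_gt0.
have /Vf : V x.
  by apply: SV; apply: (le_trans x_le); rewrite lee_fin lerD2l ge_min lexx.
rewrite ltNge => /negP; apply; apply: (le_trans x_le).
by rewrite lee_fin -lerBrDl ge_min lexx orbT.
Qed.

Lemma prox_is_minimizer : is_minimizer (prox_objective phi u) (prox phi u).
Proof.
have [p min_p] := prox_objective_has_minimizer.
suff : is_prox phi u (prox phi u) by case.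
by apply: (@xgetPex _ 0 (is_prox phi u)); exists p; split=> // q; exact: prox_unique.
Qed.

Lemma prox_eq p : is_minimizer (prox_objective phi u) p -> prox phi u = p.
Proof. by move=> min_p; exact: prox_unique prox_is_minimizer. Qed.

End ProxExistence.

(** * Separable functions along an orthonormal family *)

Lemma Gamma0_scale (R : realType) (m n : nat)
    (phi : 'M[R]_(m, n) -> \bar R) (mu : R) :
  0 < mu -> Gamma0 phi -> Gamma0 (fun w => mu%:E * phi w)%E.
Proof.
move=> mu_gt0 [[phiNy [x0 x0_fin]] phi_lsc phi_cvx]; split.
- split=> [x|]; first exact: pmule_neqNy.
  by exists x0; move: x0_fin (phiNy x0); case: (phi x0).
- move=> x a; rewrite -lte_pdivrMl // -EFinM => /phi_lsc[V Vx Vphi].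
  by exists V => // z /Vphi; rewrite EFinM lte_pdivrMl.
- move=> x y t t01; have [t_gt0 t_lt1] := andP t01.
  have t'_gt0 : 0 < 1 - t by rewrite subr_gt0.
  rewrite !(muleCA _ mu%:E) -muleDr //; last first.
    by apply: adde_def_neqNy; exact: pmule_neqNy.
  by rewrite lee_pmul2l //; exact: phi_cvx.
Qed.

Section OrthonormalFamily.
Context {R : realType} {m n k : nat} {I : finType}.
Variable E : I -> 'I_k -> 'M[R]_(m, n).
Hypothesis E_orthonormal : forall i i' j j',
  mxdot (E i j) (E i' j') = ((i == i') && (j == j'))%:R.
Implicit Types (w d : 'M[R]_(m, n)) (c : I -> 'rV[R]_k).

Definition coords w i : 'rV[R]_k := \row_j mxdot (E i j) w.

(** The adjoint of [coords], and a right inverse of it by orthonormality. *)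
Definition synth c : 'M[R]_(m, n) := \sum_i \sum_j c i 0 j *: E i j.

Lemma coordsB w d i : coords (w - d) i = coords w i - coords d i.
Proof. by apply/rowP => j; rewrite !mxE linearB. Qed.

Lemma coordsD w d i : coords (w + d) i = coords w i + coords d i.
Proof. by apply/rowP => j; rewrite !mxE linearD. Qed.

Lemma coordsZ a w i : coords (a *: w) i = a *: coords w i.
Proof. by apply/rowP => j; rewrite !mxE linearZ. Qed.

Lemma coords_continuous i : continuous (coords^~ i).
Proof.
move=> w V [P P_nbhs PV].
have : \forall w' \near w, forall a b, P a b (coords w' i a b).
  apply: (@filter_forall _ _ _ _ (nbhs_filter w)) => a.
  apply: (@filter_forall _ _ _ _ (nbhs_filter w)) => b.
  have : nbhs w (mxdot (E i b) @^-1` P a b).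
    by apply: mxdot_continuous; have := P_nbhs a b; rewrite mxE.
  by apply: filterS => w' Pw'; rewrite mxE.
by apply: filterS => w' Pw'; apply: PV.
Qed.

Lemma coords_synth c i : coords (synth c) i = c i.
Proof.
apply/rowP => j; rewrite mxE linear_sum (bigD1 i) //= [X in _ + X]big1 ?addr0.
  rewrite linear_sum (bigD1 j) //= [X in _ + X]big1 ?addr0.
    by rewrite linearZ /= E_orthonormal !eqxx mulr1.
  by move=> j' j'j; rewrite linearZ /= E_orthonormal eq_sym (negPf j'j) andbF mulr0.
move=> i' i'i; rewrite linear_sum big1 // => j' _.
by rewrite linearZ /= E_orthonormal eq_sym (negPf i'i) mulr0.
Qed.

Lemma mxdot_synth c w : mxdot w (synth c) = \sum_i mxdot (c i) (coords w i).
Proof.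
rewrite linear_sum; apply: eq_bigr => i _.
rewrite mxdotE big_ord1 linear_sum; apply: eq_bigr => j _.
by rewrite linearZ /= mxE mxdotC.
Qed.

Lemma mxdot_synth_synth c : mxdot (synth c) (synth c) = \sum_i mxdot (c i) (c i).
Proof. by rewrite mxdot_synth; apply: eq_bigr => i _; rewrite coords_synth. Qed.

(** The defect is the squared norm of w minus its projection. *)
Lemma bessel w : \sum_i mxdot (coords w i) (coords w i) <= mxdot w w.
Proof.
have := mxdot_ge0 (w - synth (coords w)).
by rewrite mxdotBB mxdot_synth_synth mxdot_synth; lra.
Qed.

Variable rho : 'rV[R]_k -> \bar R.
Hypothesis rho_Gamma0 : Gamma0 rho.

Definition separable w : \bar R := (\sum_i rho (coords w i))%E.

Let rho_neqNy z : rho z != -oo%E.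
Proof. by case: rho_Gamma0 => -[]. Qed.

Lemma separable_Gamma0 : Gamma0 separable.
Proof.
have [[_ [z0 z0_fin]] rho_lsc rho_cvx] := rho_Gamma0; split.
- split=> [w|]; first exact: sume_neqNy.
  exists (synth (fun=> z0)); rewrite /separable.
  under eq_bigr do rewrite coords_synth.
  by move: z0_fin (rho_neqNy z0); case: (rho z0) => [r||] // _ _; rewrite sumEFin.
- apply: lower_semicontinuous_sum => [i x|i]; first exact: rho_neqNy.
  exact: (lower_semicontinuous_comp (coords_continuous (i := i)) rho_lsc).
- move=> x y t t01; rewrite /separable !fin_mule_sumr // -big_split /=.
  apply: lee_sum => i _; rewrite coordsD !coordsZ.
  exact: rho_cvx.
Qed.

(** By Bessel's inequality the objective at w is at least the sum over i of the
    objectives of rho at [coords w i], and there is equality when w - y lies in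
    the range of [synth].  The candidate has such a displacement and its
    coordinates minimize each term of that sum. *)
Lemma prox_separable y :
  prox separable y = y + synth (fun i => prox rho (coords y i) - coords y i).
Proof.
set c := fun i => _ - _; apply: prox_eq; first exact: separable_Gamma0.
have sumE (d : I -> 'rV[R]_k) w :
    ((2^-1 * \sum_i mxdot (d i) (d i))%:E + separable w =
    \sum_i ((2^-1 * mxdot (d i) (d i))%:E + rho (coords w i)))%E.
  by rewrite big_split /= sumEFin mulr_sumr.
move=> w; rewrite !prox_objectiveE addrAC subrr add0r mxdot_synth_synth sumE.
apply: (@le_trans _ _ (\sum_i prox_objective rho (coords y i) (coords w i))%E).
  apply: lee_sum => i _; rewrite coordsD coords_synth [coords y i + _]addrC subrK.
  rewrite -prox_objectiveE; exact: prox_is_minimizer.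
under eq_bigr do rewrite prox_objectiveE -coordsB.
rewrite -(sumE (coords (w - y))) leeD2r // lee_fin ler_pM2l ?invr_gt0 //.
exact: bessel.
Qed.

End OrthonormalFamily.

(** * Blocks and their embeddings *)

(** Uniqueness of quotient and remainder modulo P: distinct blocks are disjoint. *)
Lemma block_index_eq (N P p : nat) (k k' : 'I_(nblocks N P p)) (i i' : 'I_P) :
  (block_index k i == block_index k' i') = (k == k') && (i == i').
Proof.
apply/eqP/andP => [/(congr1 val) /= eq_ki|[/eqP-> /eqP->]//].
have P_gt0 : (0 < P)%N by apply: leq_ltn_trans (ltn_ord i).
have {}eq_ki : (k * P + i = k' * P + i')%N.
  by apply: (@addIn p); rewrite ![(_ * P)%N]mulnC addnAC eq_ki addnAC.
split; apply/eqP/val_inj => /=.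
  by move/(congr1 (divn^~ P)): eq_ki; rewrite !divnMDl // !divn_small ?addn0.
by move/(congr1 (modn^~ P)): eq_ki; rewrite !modnMDl !modn_small.
Qed.

Lemma block_index_range (N P p : nat) (k : 'I_(nblocks N P p)) (i : 'I_P) :
  (p <= block_index k i < p + P * nblocks N P p)%N.
Proof.
rewrite /= addnAC leq_addl /= addnC ltn_add2l; apply: (@leq_trans (P * k.+1)).
  by rewrite mulnS addnC ltn_add2r.
by rewrite leq_mul2l ltn_ord orbT.
Qed.

Section Embedding.
Context {R : realType} {N1 N2 P1 P2 p1 p2 : nat}.
Local Notation I := ('I_(nblocks N1 P1 p1) * 'I_(nblocks N2 P2 p2))%type.
Implicit Types (M : 'M[R]_(P1, P2)) (w : 'M[R]_(N1, N2)) (k : I).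

(** The adjoint of [block]: this is what turns a filter response on a block
    into an inner product with the whole image ([mxdot_embed]). *)
Definition embed k M : 'M[R]_(N1, N2) :=
  \sum_a \sum_b M a b *: delta_mx (block_index k.1 a) (block_index k.2 b).

Lemma embedE k M i j : embed k M i j =
  \sum_a \sum_b M a b * ((i == block_index k.1 a) && (j == block_index k.2 b))%:R.
Proof.
rewrite summxE; apply: eq_bigr => a _; rewrite summxE; apply: eq_bigr => b _.
by rewrite !mxE.
Qed.

Lemma mxdot_delta w i j : mxdot (delta_mx i j) w = w i j.
Proof.
rewrite mxdotE (bigD1 i) //= (bigD1 j) //= mxE !eqxx mul1r.
rewrite big1 ?addr0 => [|j' /negPf j'j]; last by rewrite mxE j'j andbF mul0r.
rewrite big1 ?addr0 // => i' /negPf i'i.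
by rewrite big1 // => j' _; rewrite mxE i'i mul0r.
Qed.

Lemma mxdot_embed k M w : mxdot (embed k M) w = mxdot M (block w k.1 k.2).
Proof.
rewrite mxdotC linear_sum mxdotE; apply: eq_bigr => a _.
rewrite linear_sum; apply: eq_bigr => b _.
by rewrite linearZ /= mxdotC mxdot_delta mxE.
Qed.

Lemma block_embed k k' M :
  block (embed k M) k'.1 k'.2 = if k == k' then M else 0.
Proof.
apply/matrixP => a b; rewrite mxE embedE.
under eq_bigr do under eq_bigr do rewrite !block_index_eq.
case: k k' => [k1 k2] [k1' k2'] /=; rewrite xpair_eqE.
rewrite [k1 == k1']eq_sym [k2 == k2']eq_sym.
have [_|_] /= := eqVneq k1' k1; last first.
  by rewrite mxE big1 // => a' _; rewrite big1 // => b' _; rewrite mulr0.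
have [_|_] /= := eqVneq k2' k2; last first.
  by rewrite mxE big1 // => a' _; rewrite big1 // => b' _; rewrite andbF mulr0.
rewrite (bigD1 a) //= (bigD1 b) //= !eqxx mulr1.
rewrite big1 ?addr0 => [|b' /negPf b'b]; last by rewrite eq_sym b'b mulr0.
rewrite big1 ?addr0 // => a' /negPf a'a.
by rewrite big1 // => b' _; rewrite eq_sym a'a mulr0.
Qed.

Lemma embed_outside k M (i : 'I_N1) (j : 'I_N2) :
  [\/ (i < p1)%N, (j < p2)%N,
      (p1 + P1 * nblocks N1 P1 p1 <= i)%N |
      (p2 + P2 * nblocks N2 P2 p2 <= j)%N] ->
  embed k M i j = 0.
Proof.
move=> out; rewrite embedE big1 // => a _; rewrite big1 // => b _.
have [ia|] := eqVneq i (block_index k.1 a); last by rewrite mulr0.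
have [jb|] := eqVneq j (block_index k.2 b); last by rewrite mulr0.
have := block_index_range k.1 a; rewrite -ia => /andP[i_ge i_lt].
have := block_index_range k.2 b; rewrite -jb => /andP[j_ge j_lt].
by case: out; rewrite leqNgt ?i_ge ?j_ge ?i_lt ?j_lt // ltnS ?i_ge ?j_ge.
Qed.

Lemma blockD w w' k : block (w + w') k.1 k.2 = block w k.1 k.2 + block w' k.1 k.2.
Proof. by apply/matrixP => a b; rewrite !mxE. Qed.

Lemma block_synth (l : nat) (F : 'I_l -> 'M[R]_(P1, P2)) (c : I -> 'rV[R]_l) k :
  block (synth (fun k j => embed k (F j)) c) k.1 k.2 = \sum_j c k 0 j *: F j.
Proof.
transitivity (\sum_k' \sum_j c k' 0 j *: block (embed k' (F j)) k.1 k.2).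
  apply/matrixP => a b; rewrite mxE !summxE; apply: eq_bigr => k' _.
  by rewrite !summxE; apply: eq_bigr => j _; rewrite !mxE.
rewrite (bigD1 k) //= [X in _ + X]big1 ?addr0.
  by apply: eq_bigr => j _; rewrite block_embed eqxx.
move=> k' /negPf k'k; rewrite big1 // => j _.
by rewrite block_embed k'k scaler0.
Qed.

End Embedding.

(** * The proximity operator of the block total variation *)

Theorem proposition3p8 (R : realType) (N1 N2 P1 P2 : nat)
    (N1_gt0 : (0 < N1)%N) (N2_gt0 : (0 < N2)%N)
    (P1_gt0 : (0 < P1)%N) (P2_gt0 : (0 < P2)%N)
    (rho : 'rV[R]_2 -> \bar R) (rho_Gamma0 : Gamma0 rho)
    (H V : 'M[R]_(P1, P2)) (H_unit : frobenius H = 1) (V_unit : frobenius V = 1)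
    (HV_orth : \tr (H *m V^T) = 0)
    (y : 'M[R]_(N1, N2)) (mu : R) (mu_gt0 : 0 < mu)
    (p1 : 'I_P1) (p2 : 'I_P2) :
  let mu_tv := fun w : 'M[R]_(N1, N2) => (mu%:E * tv rho H V p1 p2 w)%E in
  let mu_rho := fun z : 'rV[R]_2 => (mu%:E * rho z)%E in
  let pi_ := prox mu_tv y in
  [/\ Gamma0 mu_tv,
      (forall (n1 : 'I_(nblocks N1 P1 p1)) (n2 : 'I_(nblocks N2 P2 p2)),
        let Y := block y n1 n2 in
        let h := \tr (H^T *m Y) in
        let v := \tr (V^T *m Y) in
        let beta := prox mu_rho (vec2 h v) 0 0 in
        let kappa := prox mu_rho (vec2 h v) 0 1 in
        block pi_ n1 n2 = (beta - h) *: H + (kappa - v) *: V + Y) &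
      (forall (n1 : 'I_N1) (n2 : 'I_N2),
        [\/ (n1 < p1)%N, (n2 < p2)%N,
            (p1 + P1 * nblocks N1 P1 p1 <= n1)%N |
            (p2 + P2 * nblocks N2 P2 p2 <= n2)%N] ->
        pi_ n1 n2 = y n1 n2)].
Proof.
move=> mu_tv mu_rho pi_.
(* The copies of H and V placed on the blocks form an orthonormal family whose
   coordinates are the filter responses. *)
pose F (j : 'I_2) := if j == 0 then H else V.
pose E (k : 'I_(nblocks N1 P1 p1) * 'I_(nblocks N2 P2 p2)) j : 'M[R]_(N1, N2) :=
  embed k (F j).
have F_orthonormal j j' : mxdot (F j) (F j') = (j == j')%:R.
  have HV0 : mxdot H V = 0 by rewrite mxdotC /mxdot mxtrace_mulC.
  have HH1 : mxdot H H = 1 by rewrite -frobenius_sqr H_unit expr1n.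
  have VV1 : mxdot V V = 1 by rewrite -frobenius_sqr V_unit expr1n.
  rewrite /F; have [j0|j0] := eqVneq j 0; have [j'0|j'0] := eqVneq j' 0.
  - by rewrite HH1 j0 j'0.
  - by rewrite HV0 j0 eq_sym (negPf j'0).
  - by rewrite mxdotC HV0 j'0 (negPf j0).
  - by rewrite VV1; case: j j' j0 j'0 => -[|[|?]] //= ? [[|[|?]] //= ?].
have E_orthonormal k k' j j' :
    mxdot (E k j) (E k' j') = ((k == k') && (j == j'))%:R.
  rewrite mxdot_embed block_embed eq_sym; case: eqP => _ /=.
    exact: F_orthonormal.
  by rewrite linear0.
have coordsE w k : coords E w k =
    vec2 (\tr (H^T *m block w k.1 k.2)) (\tr (V^T *m block w k.1 k.2)).
  by apply/rowP => j; rewrite !mxE mxdot_embed /F; case: ifP.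
have rho_neqNy z : rho z != -oo%E by case: rho_Gamma0 => -[].
have mu_rho_Gamma0 : Gamma0 mu_rho by exact: Gamma0_scale.
have mu_tvE : mu_tv = separable E mu_rho.
  apply/funext => w; rewrite /mu_tv /tv /separable pair_bigA /= fin_mule_sumr //.
  by apply: eq_bigr => k _; rewrite coordsE.
have pi_E : pi_ = y + synth E (fun k => prox mu_rho (coords E y k) - coords E y k).
  by rewrite /pi_ mu_tvE; exact: prox_separable.
split=> [|n1 n2 Y h v beta kappa|n1 n2 out].
- by rewrite mu_tvE; exact: separable_Gamma0.
- rewrite pi_E (blockD _ _ (n1, n2)) block_synth /= big_ord_recl big_ord1 addrC.
  by rewrite coordsE !mxE (_ : lift ord0 ord0 = 1) //; exact: val_inj.
- rewrite pi_E mxE summxE big1 ?addr0 // => k _; rewrite summxE big1 // => j _.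
  by rewrite mxE embed_outside ?mulr0.
Qed.
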